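(* Consider $p$ parties, where each of the first $p-1$ parties can choose among $m$ measurements, with $m$ fixed, and the last party can choose among $n>m$ measurements, with $n$ arbitrary. Let $k$ be the number of variables to be eliminated in the derivation of the Bell inequalities of this scenario by variable elimination (as described in the context; $k$ does not depend on $n$). Then all families of Bell inequalities for this scenario, with $n$ arbitrary, can be obtained by studying the case in which the last party performs $2^k$ measurements.
   Context: All measurements are dichotomic ($\{0,1\}$-valued), and measurements are compatible (jointly measurable) when they belong to different parties. For a set $I$ of measurements, $p_I$ denotes the joint probability that all measurements in $I$ have outcome $1$. The Bell inequalities of the scenario are linear inequalities in the $p_I$ with $I$ a nonempty set of compatible measurements (at most one per party). They express that these numbers come from a single classical probability space, i.e. that the vector $(p_I)$ lies in the correlation polytope, the convex hull of the vectors $\big(\prod_{A\in I}\varepsilon_A\big)_I$ over all $\{0,1\}$-assignments $\varepsilon$ to the measurements. Derivation by variable elimination: let $\mathcal F$ be the set of the $(p-1)m$ measurements of the first $p-1$ parties. A classical description of the whole scenario exists if and only if, for the measurements $s$ of the last party, there are classical descriptions of the subsystems $\mathcal F\cup\{s\}$ that coincide on $\mathcal F$. For each $s$, take the system of linear inequalities describing the correlation polytope with coordinates $p_J$ for all nonempty $J\subset\mathcal F$ (compatible or not), $p_s$, and $p_{I\cup\{s\}}$ for the nonempty compatible sets $I\subset\mathcal F$. Systems for different $s$ are copies of one another with a different index $s$, sharing the variables $p_J$. Put the systems for all $s$ together and eliminate, by the Fourier-Motzkin method, the variables $p_J$ with $J\subset\mathcal F$ containing incompatible measurements (two or more measurements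 of one party). These are the variables to be eliminated, and $k$ is their number. Fourier-Motzkin elimination of one variable keeps the inequalities not containing it and replaces the others by all sums of pairs (normalized) in which it appears with opposite signs. The inequalities that result after eliminating all $k$ variables are the Bell inequalities obtained by the method. A ''family'' of inequalities consists of inequalities that have the same form and differ only in which measurements of the last party enter. For example, for two parties with $m=2$ and $k=1$, all families of inequalities arise from inequalities involving at most two measurements $i,j$ of the last party, with $\{i,j\}$ any pair of them. *)

(* Defs.v *)
From HB Require Import structures.
From mathcomp Require Import all_boot all_order all_algebra.

Set Implicit Arguments.
Unset Strict Implicit.
Unset Printing Implicit Defensive.

Import Order.TTheory GRing.Theory Num.Theory.
Local Open Scope ring_scope.

(** ** Linear inequalities and Fourier-Motzkin elimination *)

(** [a : lineq R T] stands for [0 <= a.1 + \sum_v a.2 v * x v], where the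
    finite type [T] indexes the variables. *)
Definition lineq (R : realFieldType) (T : finType) : Type :=
  (R * {ffun T -> R})%type.

Definition satisfies (R : realFieldType) (T : finType)
    (a : lineq R T) (x : T -> R) : Prop :=
  0 <= a.1 + \sum_v a.2 v * x v.

(** The sum of [a] and [b], first normalized so that [v] has coefficients [1]
    and [-1]; used only when [0 < a.2 v] and [b.2 v < 0]. *)
Definition fm_combine (R : realFieldType) (T : finType) (v : T)
    (a b : lineq R T) : lineq R T :=
  (a.1 / `|a.2 v| + b.1 / `|b.2 v|,
   [ffun u => a.2 u / `|a.2 v| + b.2 u / `|b.2 v|]).

Definition fm_step (R : realFieldType) (T : finType)
    (S : seq (lineq R T)) (v : T) : seq (lineq R T) :=
  [seq a : lineq R T <- S | a.2 v == 0] ++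
  [seq fm_combine v a b | a <- [seq a : lineq R T <- S | 0 < a.2 v],
                          b <- [seq b : lineq R T <- S | b.2 v < 0]].

Definition fourier_motzkin (R : realFieldType) (T : finType)
    (S : seq (lineq R T)) (vs : seq T) : seq (lineq R T) :=
  foldl (@fm_step R T) S vs.

(** ** Measurements *)

(** The set of measurements of the first [p - 1] parties: the pair [(i, j)] is
    the [j]-th measurement of the [i]-th party. *)
Definition first_meas (p m : nat) : finType := ('I_p.-1 * 'I_m)%type.

(** All measurements; [inr s] is the [s]-th measurement of the last party. *)
Definition meas (p m n : nat) : finType := (first_meas p m + 'I_n)%type.

(** [None] is the last party. *)
Definition party (p m n : nat) (A : meas p m n) : option 'I_p.-1 :=
  match A with inl f => Some f.1 | inr _ => None end.

Definition compatible (p m n : nat) (I : {set meas p m n}) : bool :=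
  [forall A in I, forall B in I, (party A == party B) ==> (A == B)].

(** A set of measurements of the first parties, seen in the whole scenario. *)
Definition first_set (p m n : nat) (J : {set first_meas p m}) :
    {set meas p m n} :=
  [set inl f | f in J].

(** The coordinates of the Bell inequalities. *)
Definition bell_coord (p m n : nat) : {set {set meas p m n}} :=
  [set I | (I != set0) && compatible I].

(** The coordinates before elimination: in addition, all nonempty sets of
    measurements of the first parties, compatible or not. *)
Definition ext_coord (p m n : nat) : {set {set meas p m n}} :=
  [set I | (I != set0) && ((I \subset first_set n setT) || compatible I)].

(** The indices of the variables to be eliminated.  They do not depend on the
    number of measurements of the last party, which is set to [0] here; the
    empty set, being compatible, is not among them. *)
Definition elim_vars (p m : nat) : {set {set first_meas p m}} :=
  [set J | ~~ compatible (first_set 0 J)].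

Definition num_elim (p m : nat) : nat := #|elim_vars p m|.

(** ** Correlation polytopes *)

(** The correlation polytope with coordinates in [D]: [x] agrees on [D] with a
    convex combination of the vectors [\prod_(A in I) eps A]; the values of
    [x] outside [D] are irrelevant. *)
Definition corr_polytope (R : realFieldType) (T : finType)
    (D : {set {set T}}) (x : {set T} -> R) : Prop :=
  exists w : {ffun {ffun T -> bool} -> R},
    [/\ forall eps, 0 <= w eps,
        \sum_eps w eps = 1 &
        forall I, I \in D ->
          x I = \sum_eps w eps * \prod_(A in I) (eps A)%:R].

(** [S] is a system of linear inequalities in the variables [x I], [I \in D],
    whose solution set is the correlation polytope. *)
Definition describes_polytope (R : realFieldType) (T : finType)
    (S : seq (lineq R {set T})) (D : {set {set T}}) : Prop :=
  (forall a, a \in S -> forall I, I \notin D -> a.2 I = 0) /\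
  (forall x : {set T} -> R,
     (forall a, a \in S -> satisfies a x) <-> corr_polytope D x).

(** ** The derivation by variable elimination *)

Definition relabel (p m n n' : nat) (g : 'I_n -> 'I_n') (A : meas p m n) :
    meas p m n' :=
  match A with inl f => inl f | inr s => inr (g s) end.

(** A subsystem consisting of the first parties and one measurement of the last
    party is modelled by [meas p m 1]; [copy_at s a] is the inequality [a] with
    that measurement taken to be [s]. *)
Definition copy_at (R : realFieldType) (p m n : nat) (s : 'I_n)
    (a : lineq R {set meas p m 1}) : lineq R {set meas p m n} :=
  (a.1,
   [ffun I : {set meas p m n} =>
      if I \subset inr s |: first_set n setT
      then a.2 [set relabel (fun=> ord0) A | A in I] else 0]).

Definition joint_system (R : realFieldType) (p m n : nat)
    (L : seq (lineq R {set meas p m 1})) : seq (lineq R {set meas p m n}) :=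
  [seq copy_at s a | s <- enum 'I_n, a <- L].

(** The inequalities obtained when the last party has [n] measurements, from
    the system [L] for one subsystem and the elimination order [e]. *)
Definition bell_inequalities (R : realFieldType) (p m : nat)
    (L : seq (lineq R {set meas p m 1})) (e : seq {set first_meas p m})
    (n : nat) : seq (lineq R {set meas p m n}) :=
  fourier_motzkin (joint_system n L) [seq first_set n J | J <- e].

(** ** Families *)

(** The measurements of the last party that enter an inequality. *)
Definition entering (R : realFieldType) (p m n : nat)
    (c : lineq R {set meas p m n}) : {set 'I_n} :=
  [set s | [exists I : {set meas p m n}, (inr s \in I) && (c.2 I != 0)]].

(** The inequalities [c] and [c'] have the same form up to a bijection [g]
    between the measurements of the last party entering them; the values of
    [g] outside [entering c] are irrelevant. *)
Definition same_family (R : realFieldType) (p m n n' : nat)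
    (c : lineq R {set meas p m n}) (c' : lineq R {set meas p m n'}) : Prop :=
  exists g : 'I_n -> 'I_n',
    [/\ {in entering c &, injective g},
        entering c' = g @: entering c,
        c'.1 = c.1 &
        forall I : {set meas p m n},
          (forall s, inr s \in I -> s \in entering c) ->
          c'.2 [set relabel g A | A in I] = c.2 I].

(* Main.v *)
(** The eliminated variables do not involve the last party, so any relabelling
    of its measurements, pushed forward onto coefficients, leaves every sign
    that governs the elimination unchanged and maps derivations to derivations.
    An inequality left after [k] eliminations combines at most [2 ^ k] of the
    initial ones, each involving at most one measurement of the last party;
    hence its entering measurements embed into a set of size [2 ^ k], which
    transports it to [N = 2 ^ k]. Conversely, a non-injective relabelling brings
    it back even when [n < 2 ^ k], since it only merges measurements whose
    coefficients have cancelled.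

    For the description of the polytope, Möbius inversion shows that two
    subsystems with the same [p_J] for all [J] have the same marginal on the
    first parties, and they are glued along it by conditional independence. *)

Require Import Defs.
From HB Require Import structures.
From mathcomp Require Import all_boot all_order all_algebra.
From mathcomp Require Import ring.

Set Implicit Arguments.
Unset Strict Implicit.
Unset Printing Implicit Defensive.

Import Order.TTheory GRing.Theory Num.Theory.
Local Open Scope ring_scope.

(** The dual of precomposing points with [phi]: coefficients of variables identified by [phi] are
    added, and a variable outside the image gets [0]. *)
Definition pushforward (R : realFieldType) (T T' : finType) (phi : T -> T')
    (a : lineq R T) : lineq R T' :=
  (a.1, [ffun u => \sum_(v | phi v == u) a.2 v]).

(** * Soundness and completeness of Fourier-Motzkin elimination *)

Section FourierMotzkin.
Variables (R : realFieldType) (T : finType).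
Implicit Types (a b c : lineq R T) (S : seq (lineq R T)) (x y : T -> R).
Implicit Types (u v : T) (vs : seq T).

Definition lineq_eval a x : R := a.1 + \sum_v a.2 v * x v.

Lemma lineq_eval_with a x v t :
  lineq_eval a [eta x with v |-> t] = lineq_eval a x + a.2 v * (t - x v).
Proof.
rewrite /lineq_eval (bigD1 v) //= [in RHS](bigD1 v) //= eqxx.
under eq_bigr => u /negPf -> do [].
ring.
Qed.

Lemma lineq_eval_combine v a b x :
  lineq_eval (fm_combine v a b) x =
  lineq_eval a x / `|a.2 v| + lineq_eval b x / `|b.2 v|.
Proof.
rewrite /lineq_eval /=; under eq_bigr => u _ do rewrite ffunE mulrDl.
rewrite big_split /= !mulrDl !mulr_suml addrACA; congr (_ + _ + (_ + _));
  by apply: eq_bigr => u _; rewrite mulrAC.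
Qed.

Lemma fm_stepP S v c :
  reflect ((c \in S /\ c.2 v = 0) \/
           exists a b, [/\ a \in S, b \in S, 0 < a.2 v, b.2 v < 0 &
                           c = fm_combine v a b])
          (c \in fm_step S v).
Proof.
rewrite /fm_step mem_cat mem_filter; apply: (iffP orP).
  case=> [/andP[/eqP ? ?]|/allpairsP[[a b] /= []]]; first by left.
  by rewrite !mem_filter => /andP[? ?] /andP[? ?] ->; right; exists a, b.
case=> [[-> ->]|[a [b [aS bS av bv ->]]]]; first by left; rewrite eqxx.
by right; apply/allpairsP; exists (a, b); rewrite !mem_filter av bv aS bS.
Qed.

Lemma fm_combine_eq0 v a b u :
  a.2 u = 0 -> b.2 u = 0 -> (fm_combine v a b).2 u = 0.
Proof. by move=> a0 b0; rewrite ffunE a0 b0 !mul0r addr0. Qed.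

Lemma fm_combine_elim v a b :
  0 < a.2 v -> b.2 v < 0 -> (fm_combine v a b).2 v = 0.
Proof.
move=> av bv; rewrite ffunE gtr0_norm // ltr0_norm // invrN mulrN.
by rewrite divff ?lt0r_neq0 // divff ?ltr0_neq0 // subrr.
Qed.

Lemma fm_step_elim S v c : c \in fm_step S v -> c.2 v = 0.
Proof.
by case/fm_stepP => [[]//|[a [b [_ _ av bv ->]]]]; rewrite fm_combine_elim.
Qed.

Lemma fourier_motzkin_eq0 S vs u c :
  (forall a, a \in S -> a.2 u = 0) -> c \in fourier_motzkin S vs -> c.2 u = 0.
Proof.
elim: vs S => [|v vs IH] S S0 /=; first exact: S0.
apply: IH => a /fm_stepP[[/S0]//|[a1 [b [/S0 ? /S0 ? _ _ ->]]]].
exact: fm_combine_eq0.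
Qed.

Lemma fourier_motzkin_elim S vs u c :
  u \in vs -> c \in fourier_motzkin S vs -> c.2 u = 0.
Proof.
elim: vs S => // v vs IH S; rewrite inE /= => /orP[/eqP ->|]; last exact: IH.
by apply: fourier_motzkin_eq0 => a; apply: fm_step_elim.
Qed.

Lemma fm_step_sound S v x :
  (forall a, a \in S -> satisfies a x) ->
  forall c, c \in fm_step S v -> satisfies c x.
Proof.
move=> Sx c /fm_stepP[[/Sx]//|[a [b [/Sx ax /Sx bx _ _ ->]]]].
by rewrite /satisfies -/(lineq_eval _ x) lineq_eval_combine addr_ge0 // divr_ge0.
Qed.

Lemma fourier_motzkin_sound S vs x :
  (forall a, a \in S -> satisfies a x) ->
  forall c, c \in fourier_motzkin S vs -> satisfies c x.
Proof. by elim: vs S => //= v vs IH S /(fm_step_sound (v := v)); apply: IH. Qed.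

Lemma seq_le_separated (l r : seq R) :
  (forall s t, s \in l -> t \in r -> s <= t) ->
  exists t, (forall s, s \in l -> s <= t) /\ (forall s, s \in r -> t <= s).
Proof.
elim: l => [_|x l IH lr].
  elim: r => [|y r [t [_ rt]]]; first by exists 0.
  exists (Num.min y t); split=> // z; rewrite inE => /predU1P[->|/rt tz].
    by rewrite ge_min lexx.
  by rewrite ge_min tz orbT.
have [|t [lt rt]] := IH; first by move=> z y zl; apply: lr; rewrite inE zl orbT.
exists (Num.max x t); split=> z.
  by rewrite inE le_max => /predU1P[->|/lt ->]; rewrite ?lexx ?orbT.
by move=> zr; rewrite ge_max rt // lr // mem_head.
Qed.

(** Positive coefficients at [v] give lower bounds and negative ones upper bounds; the sums of pairs
    say exactly that every lower bound is at most every upper bound. *)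
Lemma fm_step_complete S v x :
  (forall c, c \in fm_step S v -> satisfies c x) ->
  exists t, forall a, a \in S -> satisfies a [eta x with v |-> t].
Proof.
move=> Sx.
pose l := [seq - (lineq_eval a x / `|a.2 v|) | a <- S & 0 < a.2 v].
pose r := [seq lineq_eval b x / `|b.2 v| | b : lineq R T <- S & b.2 v < 0].
have [y z|t [lt rt]] := @seq_le_separated l r.
  case/mapP=> a; rewrite mem_filter => /andP[av aS] ->.
  case/mapP=> b; rewrite mem_filter => /andP[bv bS] ->.
  have /Sx : fm_combine v a b \in fm_step S v.
    by apply/fm_stepP; right; exists a, b.
  rewrite /satisfies -/(lineq_eval _ x) lineq_eval_combine => ab_ge0.
  by rewrite -subr_ge0 opprK addrC.
(* The bounds in [l] and [r] concern the increment over [x v], not the value at [v] itself. *)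
exists (t + x v) => a aS.
rewrite /satisfies -/(lineq_eval a _) lineq_eval_with addrK.
have [av|av|av] := ltgtP (a.2 v) 0.
- have /rt : lineq_eval a x / `|a.2 v| \in r.
    by apply/mapP; exists a; rewrite // mem_filter av.
  rewrite ltr0_norm // ler_pdivlMr ?oppr_gt0 // mulrN mulrC => tle.
  by rewrite -[_ * t]opprK subr_ge0.
- have /lt : - (lineq_eval a x / `|a.2 v|) \in l.
    by apply/mapP; exists a; rewrite // mem_filter av.
  rewrite gtr0_norm // -mulNr ler_pdivrMr // mulrC => tge.
  by rewrite addrC -[lineq_eval _ _]opprK subr_ge0.
- rewrite av mul0r addr0; apply: Sx; apply/fm_stepP.
  by left; split.
Qed.

(** Back substitution: the variables eliminated later receive their values first, and the head of
    the list last. *)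
Lemma fourier_motzkin_complete S vs x :
  (forall c, c \in fourier_motzkin S vs -> satisfies c x) ->
  exists y, (forall u, u \notin vs -> y u = x u) /\
            forall a, a \in S -> satisfies a y.
Proof.
elim: vs S => [|v vs IH] S Sx; first by exists x.
have [y [yx /fm_step_complete[t Sy]]] := IH _ Sx.
exists [eta y with v |-> t]; split=> // u; rewrite inE negb_or /= => /andP[].
by move=> /negPf ->; apply: yx.
Qed.

End FourierMotzkin.

(** * Pushing inequalities forward along a map of variables *)

Section Pushforward.
Variables (R : realFieldType) (T T' : finType) (phi : T -> T').
Implicit Types (a b : lineq R T).

Lemma satisfies_pushforward a (x : T' -> R) :
  satisfies (pushforward phi a) x <-> satisfies a (x \o phi).
Proof.
rewrite /satisfies /= [in X in _ <-> X](partition_big phi xpredT) //=.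
under eq_bigr => u _ do rewrite ffunE mulr_suml.
suff -> : \sum_u \sum_(v | phi v == u) a.2 v * x u =
          \sum_u \sum_(v | phi v == u) a.2 v * x (phi v) by [].
by apply: eq_bigr => u _; apply: eq_bigr => v /eqP ->.
Qed.

Lemma pushforward_fiber1 a v :
  (forall u, phi u = phi v -> u = v) -> (pushforward phi a).2 (phi v) = a.2 v.
Proof.
move=> phiv; rewrite ffunE (big_pred1 v) // => u.
by apply/eqP/eqP => [/phiv|->].
Qed.

Lemma pushforward_combine v a b : (forall u, phi u = phi v -> u = v) ->
  pushforward phi (fm_combine v a b) =
  fm_combine (phi v) (pushforward phi a) (pushforward phi b).
Proof.
move=> phiv; rewrite /fm_combine !pushforward_fiber1 //; congr pair.
apply/ffunP => u; rewrite !ffunE !mulr_suml -big_split /=.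
by apply: eq_bigr => w _; rewrite ffunE.
Qed.

(** An eliminated variable alone in its fibre keeps its coefficient, hence its sign and
    normalization, so each step is carried over; all other variables may be merged. *)
Lemma pushforward_fourier_motzkin S S' vs c :
  (forall v, v \in vs -> forall u, phi u = phi v -> u = v) ->
  (forall a, a \in S -> pushforward phi a \in S') ->
  c \in fourier_motzkin S vs ->
  pushforward phi c \in fourier_motzkin S' (map phi vs).
Proof.
elim: vs S S' => [|v vs IH] S S' inj SS' /=; first exact: SS'.
have phiv := inj v (mem_head _ _).
apply: IH => [w wvs|a]; first by apply: inj; rewrite inE wvs orbT.
case/fm_stepP=> [[aS av]|[a1 [b [aS bS av bv ->]]]]; apply/fm_stepP.
  by left; rewrite pushforward_fiber1 ?SS'.
right; exists (pushforward phi a1), (pushforward phi b).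
by rewrite !pushforward_fiber1 // pushforward_combine //; split; rewrite ?SS'.
Qed.

End Pushforward.

Lemma pushforward_comp (R : realFieldType) (T T' T'' : finType)
    (phi : T -> T') (psi : T' -> T'') (a : lineq R T) :
  pushforward psi (pushforward phi a) = pushforward (psi \o phi) a.
Proof.
congr pair; apply/ffunP => u; rewrite !ffunE.
rewrite [RHS](partition_big phi (fun w => psi w == u)) //=.
apply: eq_bigr => w /eqP <-; rewrite ffunE; apply: eq_bigl => v.
by case: (phi v =P w) => [->|]; rewrite ?eqxx ?andbF.
Qed.

Lemma eq_pushforward (R : realFieldType) (T T' : finType)
    (phi psi : T -> T') (a : lineq R T) :
  phi =1 psi -> pushforward phi a = pushforward psi a.
Proof.
move=> e; congr pair; apply/ffunP => u; rewrite !ffunE.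
by apply: eq_bigl => v; rewrite e.
Qed.

(** * Relabelling the measurements of the last party *)

Definition relabel_set (p m n n' : nat) (g : 'I_n -> 'I_n')
    (I : {set meas p m n}) : {set meas p m n'} :=
  [set relabel g A | A in I].

Section Relabelling.
Variables (p m : nat).

Lemma mem_first_set_inl n (J : {set first_meas p m}) f :
  (inl f \in first_set n J) = (f \in J).
Proof. by apply/imsetP/idP => [[f' f'J [->]]|fJ] //; exists f. Qed.

Lemma mem_first_set_inr n (J : {set first_meas p m}) s :
  (inr s \in first_set n J) = false.
Proof. by apply/imsetP => -[]. Qed.

Lemma mem_relabel_set_inl n n' (g : 'I_n -> 'I_n') (I : {set meas p m n}) f :
  (inl f \in relabel_set g I) = (inl f \in I).
Proof.
by apply/imsetP/idP => [[[f'|//] f'I [->]]|fI] //; exists (inl f).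
Qed.

Lemma mem_relabel_set_inr n n' (g : 'I_n -> 'I_n') (I : {set meas p m n}) t :
  reflect (exists2 s, inr s \in I & t = g s) (inr t \in relabel_set g I).
Proof.
apply: (iffP imsetP) => [[[//|s] sI [->]]|[s sI ->]]; first by exists s.
by exists (inr s).
Qed.

Lemma relabel_set_comp n n' n'' (g : 'I_n -> 'I_n') (h : 'I_n' -> 'I_n'') :
  relabel_set (p := p) (m := m) h \o relabel_set g =1 relabel_set (h \o g).
Proof.
by move=> I; rewrite /= /relabel_set -imset_comp; apply: eq_imset => -[].
Qed.

Lemma relabel_set_first n n' (g : 'I_n -> 'I_n') (J : {set first_meas p m}) :
  relabel_set g (first_set n J) = first_set n' J.
Proof. by rewrite /relabel_set -imset_comp. Qed.

(** A relabelling may merge measurements of the last party but never removes the last of them from a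
    set. Eliminated variables are therefore alone in their fibres, even when [g] is not
    injective. *)
Lemma relabel_set_first_inj n n' (g : 'I_n -> 'I_n') I
    (J : {set first_meas p m}) :
  relabel_set g I = relabel_set g (first_set n J) -> I = first_set n J.
Proof.
rewrite relabel_set_first => gI; apply/setP => -[f|s].
  by rewrite -(mem_relabel_set_inl g) gI !mem_first_set_inl.
rewrite mem_first_set_inr; apply/negbTE/negP => sI.
have: inr (g s) \in relabel_set g I by apply/mem_relabel_set_inr; exists s.
by rewrite gI mem_first_set_inr.
Qed.

Lemma relabel_set_inj_in n n' (g : 'I_n -> 'I_n') (E : {set 'I_n})
    (I1 I2 : {set meas p m n}) :
  {in E &, injective g} ->
  (forall s, inr s \in I1 -> s \in E) -> (forall s, inr s \in I2 -> s \in E) ->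
  relabel_set g I1 = relabel_set g I2 -> I1 = I2.
Proof.
have sub (K1 K2 : {set meas p m n}) : {in E &, injective g} ->
    (forall s, inr s \in K1 -> s \in E) ->
    (forall s, inr s \in K2 -> s \in E) ->
    relabel_set g K1 = relabel_set g K2 -> K1 \subset K2.
  move=> ginj K1E K2E eqK; apply/subsetP => -[f|s] sK1.
    by rewrite -(mem_relabel_set_inl g) -eqK mem_relabel_set_inl.
  have: inr (g s) \in relabel_set g K1 by apply/mem_relabel_set_inr; exists s.
  rewrite eqK => /mem_relabel_set_inr[t tK2 /ginj ->] //; first exact: K1E.
  exact: K2E.
by move=> ginj E1 E2 eqI; apply/eqP; rewrite eqEsubset !sub.
Qed.

Lemma relabel_setK_copy n (s : 'I_n) :
  cancel (relabel_set (p := p) (m := m) (fun=> s))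
         (relabel_set (fun=> ord0 : 'I_1)).
Proof.
move=> K; have := relabel_set_comp (fun=> s) (fun=> ord0 : 'I_1) K.
move=> /= ->; rewrite /relabel_set -[RHS]imset_id; apply: eq_imset => -[//|t].
by rewrite /= (ord1 t).
Qed.

Lemma relabel_set_copyK n (s : 'I_n) (I : {set meas p m n}) :
  I \subset inr s |: first_set n setT ->
  relabel_set (fun=> s) (relabel_set (fun=> ord0 : 'I_1) I) = I.
Proof.
move=> /subsetP sI.
have := relabel_set_comp (fun=> ord0 : 'I_1) (fun=> s) I.
move=> /= ->; rewrite /relabel_set -[RHS]imset_id; apply: eq_in_imset.
move=> [//|t] /sI; rewrite inE mem_first_set_inr orbF inE.
by move=> /eqP[->].
Qed.

Lemma relabel_set_copy_sub n (s : 'I_n) (K : {set meas p m 1}) :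
  relabel_set (fun=> s) K \subset inr s |: first_set n setT.
Proof.
apply/subsetP => -[f|t]; rewrite inE; first by rewrite mem_first_set_inl !inE.
by move=> /mem_relabel_set_inr[_ _ ->]; rewrite inE eqxx.
Qed.

(** Naming the single measurement [s] is injective on sets, with image the subsets of the subsystem
    of [s], so each fibre sum has at most one term. Copying then composes with relabelling. *)
Lemma copy_atE (R : realFieldType) n (s : 'I_n) (a : lineq R {set meas p m 1}) :
  copy_at s a = pushforward (relabel_set (fun=> s)) a.
Proof.
congr pair; apply/ffunP => I; rewrite !ffunE; case: ifP => sI.
  rewrite (big_pred1 (relabel_set (fun=> ord0) I)) // => K.
  apply/eqP/eqP => [<-|->]; first by rewrite relabel_setK_copy.
  exact: relabel_set_copyK.
rewrite big1 // => K /eqP KI.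
by rewrite -KI relabel_set_copy_sub in sI.
Qed.

Lemma joint_systemP (R : realFieldType) n (L : seq (lineq R {set meas p m 1})) c :
  reflect (exists s : 'I_n, exists2 a, a \in L & c = copy_at s a)
          (c \in joint_system n L).
Proof.
apply: (iffP allpairsP) => [[[s a] /= [_ aL ->]]|[s [a aL ->]]].
  by exists s, a.
by exists (s, a); split; rewrite //= mem_enum.
Qed.

End Relabelling.

(** * Families and the number of entering measurements *)

Section Families.
Variables (R : realFieldType) (p m : nat).
Variables (L : seq (lineq R {set meas p m 1})) (e : seq {set first_meas p m}).

(* Relabelling, even non-injectively, fixes the eliminated variables, which do
   not involve the last party; hence it preserves the whole elimination. *)
Lemma pushforward_bell_inequalities n n' (g : 'I_n -> 'I_n') c :
  c \in bell_inequalities L e n ->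
  pushforward (relabel_set g) c \in bell_inequalities L e n'.
Proof.
move=> cB; rewrite /bell_inequalities.
have -> : [seq first_set n' J | J <- e] =
          map (relabel_set g) [seq first_set n J | J <- e].
  by rewrite -map_comp; apply: eq_map => J /=; rewrite relabel_set_first.
apply: pushforward_fourier_motzkin cB => [v /mapP[J _ ->] I|a].
  exact: relabel_set_first_inj.
move=> /joint_systemP[s [a0 a0L ->]]; apply/joint_systemP; exists (g s).
exists a0; rewrite // !copy_atE pushforward_comp; apply: eq_pushforward.
exact: relabel_set_comp.
Qed.

Lemma enteringP n (c : lineq R {set meas p m n}) s :
  reflect (exists2 I : {set meas p m n}, inr s \in I & c.2 I != 0)
          (s \in entering c).
Proof.
rewrite inE; apply: (iffP existsP) => [[I /andP[]]|[I sI cI]]; first by exists I.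
by exists I; rewrite sI.
Qed.

Lemma entering_combine n v (a b : lineq R {set meas p m n}) :
  entering (fm_combine v a b) \subset entering a :|: entering b.
Proof.
apply/subsetP => s /enteringP[I sI]; rewrite inE; apply: contraR.
rewrite negb_or => /andP[/enteringP sa /enteringP sb].
apply/eqP; apply: fm_combine_eq0; apply/eqP; apply: contraTT isT => cI.
  by case: sa; exists I.
by case: sb; exists I.
Qed.

(** Each elimination at most doubles the bound, since only measurements entering one of the two
    parents can enter a combination. *)
Lemma card_entering_fourier_motzkin n k S vs (c : lineq R {set meas p m n}) :
  (forall a, a \in S -> #|entering a| <= k)%N ->
  c \in fourier_motzkin S vs -> (#|entering c| <= k * 2 ^ size vs)%N.
Proof.
elim: vs S k => [|v vs IH] S k Sk /=; first by rewrite muln1; apply: Sk.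
rewrite expnS mulnA; apply: IH => a /fm_stepP[[/Sk ak _]|].
  by rewrite (leq_trans ak) // leq_pmulr.
case=> a1 [b [/Sk a1k /Sk bk _ _ ->]].
rewrite (leq_trans (subset_leq_card (entering_combine _ _ _))) //.
by rewrite (leq_trans (leq_card_setU _ _)) // muln2 -addnn leq_add.
Qed.

Lemma entering_copy_at n (s : 'I_n) (a : lineq R {set meas p m 1}) :
  entering (copy_at s a) \subset [set s].
Proof.
apply/subsetP => t /enteringP[I tI]; rewrite ffunE; case: ifP; rewrite ?eqxx //.
move=> /subsetP/(_ _ tI); rewrite inE mem_first_set_inr orbF !inE.
by move=> /eqP[->].
Qed.

Lemma card_entering_bell n c :
  c \in bell_inequalities L e n -> (#|entering c| <= 2 ^ size e)%N.
Proof.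
move=> cB; rewrite -(size_map (first_set n)) -[leqRHS]mul1n.
apply: card_entering_fourier_motzkin cB => _ /joint_systemP[s [a _ ->]].
by rewrite -(cards1 s) subset_leq_card // entering_copy_at.
Qed.

Lemma entering_support n (c : lineq R {set meas p m n}) I s :
  c.2 I != 0 -> inr s \in I -> s \in entering c.
Proof. by move=> cI sI; apply/enteringP; exists I. Qed.

(** Any set with nonzero coefficient has only entering measurements of the last party, where [g] is
    injective; so no two nonzero coefficients are added together. *)
Lemma same_family_pushforward n n' (g : 'I_n -> 'I_n')
    (c : lineq R {set meas p m n}) :
  {in entering c &, injective g} ->
  same_family c (pushforward (relabel_set g) c).
Proof.
move=> ginj.
have pushE (I : {set meas p m n}) : (forall s, inr s \in I -> s \in entering c) ->
    (pushforward (relabel_set g) c).2 (relabel_set g I) = c.2 I.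
  move=> sI; rewrite ffunE (bigD1 I) //= big1 ?addr0 // => K /andP[/eqP eqK].
  apply: contraNeq => cK; apply/eqP; apply: relabel_set_inj_in ginj _ sI eqK.
  by move=> s; apply: entering_support.
exists g; split=> //; apply/setP => t; apply/enteringP/imsetP.
  case=> I tI; rewrite ffunE => sum_neq0.
  have /existsP[K /andP[/eqP eqK cK]] :
      [exists K, (relabel_set g K == I) && (c.2 K != 0)].
    apply: contraNT sum_neq0 => /existsPn noK.
    rewrite big1 // => K KI; apply/eqP; apply: contraNT (noK K) => cK.
    by rewrite KI.
  move: tI; rewrite -eqK => /mem_relabel_set_inr[s sK ->].
  by exists s; rewrite // (entering_support cK).
case=> s /enteringP[I sI cI] ->; exists (relabel_set g I).
  by apply/mem_relabel_set_inr; exists s.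
by rewrite pushE // => r; apply: entering_support.
Qed.

(** An inverse of the family bijection recovers [c] from [c']; as pushforwards preserve derivations,
    this yields the converse half of the correspondence. *)
Lemma same_family_pushforwardK n n' (c : lineq R {set meas p m n})
    (c' : lineq R {set meas p m n'}) :
  (0 < n)%N -> same_family c c' ->
  exists h : 'I_n' -> 'I_n, pushforward (relabel_set h) c' = c.
Proof.
case: n c => // n c _ [g [ginj entE c'1 c'2]].
(* Off the image of the entering measurements [h] takes the default [ord0], available since [n] is
   positive; no such measurement enters [c']. *)
pose h t := odflt ord0 [pick s in entering c | g s == t].
have gK : {in entering c, cancel g h}.
  move=> s sc; rewrite /h; case: pickP => [r /andP[rc /eqP /ginj ->]|] //.
  by move/(_ s); rewrite /= sc eqxx.
have hK : {in entering c', cancel h g}.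
  by move=> t; rewrite entE => /imsetP[s sc ->]; rewrite gK.
have hg_id (I : {set meas p m n'}) : c'.2 I != 0 -> relabel_set g (relabel_set h I) = I.
  move=> c'I; have /= -> := relabel_set_comp h g I.
  rewrite /relabel_set -[RHS]imset_id; apply: eq_in_imset => -[//|t] tI /=.
  by rewrite hK // (entering_support c'I).
exists h; apply: injective_projections; first by rewrite /= c'1.
apply/ffunP => I; rewrite ffunE.
(* If every measurement of the last party in [I] enters [c], only [relabel_set g I] can contribute
   to the fibre over [I]; otherwise both sides vanish. *)
have [sI|] := boolP [forall s, (inr s \in I) ==> (s \in entering c)].
  have {}sI s : inr s \in I -> s \in entering c by apply/implyP/(forallP sI).
  rewrite (bigD1 (relabel_set g I)) /=.
    rewrite c'2 // big1 ?addr0 // => K /andP[/eqP <-].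
    by apply: contraNeq => /hg_id ->.
  have /= -> := relabel_set_comp g h I.
  rewrite /relabel_set -[eqbRHS]imset_id; apply/eqP/eq_in_imset => -[//|s] /sI.
  by rewrite /= => /gK ->.
rewrite negb_forall => /existsP[s]; rewrite negb_imply => /andP[sI sNc].
have -> : c.2 I = 0.
  by apply/eqP; apply: contraNT sNc => /entering_support; apply.
rewrite big1 // => K /eqP KI; apply/eqP; apply: contraNT sNc => c'K.
move: sI; rewrite -KI => /mem_relabel_set_inr[t /(entering_support c'K)].
by rewrite entE => /imsetP[r rc ->] ->; rewrite gK.
Qed.

Lemma exists_inj_in_ord n N (E : {set 'I_n}) : (0 < N)%N -> (#|E| <= N)%N ->
  exists g : 'I_n -> 'I_N, {in E &, injective g}.
Proof.
case: N => // N _ EN; exists (fun s => inord (index s (enum E))) => s t sE tE.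
move=> /(congr1 (@nat_of_ord _)).
have lt_index r : r \in E -> (index r (enum E) < N.+1)%N.
  by move=> rE; rewrite (leq_trans _ EN) // cardE index_mem mem_enum.
rewrite !inordK ?lt_index // => /(congr1 (nth s (enum E))).
by rewrite !nth_index ?mem_enum.
Qed.

Lemma bell_inequalities_families n N (c : lineq R {set meas p m n}) :
  (0 < n)%N -> (2 ^ size e <= N)%N ->
  c \in bell_inequalities L e n <->
  exists2 c' : lineq R {set meas p m N},
    c' \in bell_inequalities L e N & same_family c c'.
Proof.
move=> n_gt0 leN; have N_gt0 : (0 < N)%N by rewrite (leq_trans _ leN) ?expn_gt0.
split=> [cB|[c' c'B /(same_family_pushforwardK n_gt0)[h <-]]].
  have leE := leq_trans (card_entering_bell cB) leN.
  have [g ginj] := exists_inj_in_ord N_gt0 leE.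
  exists (pushforward (relabel_set g) c).
    exact: pushforward_bell_inequalities.
  exact: same_family_pushforward.
exact: pushforward_bell_inequalities.
Qed.

End Families.

(** * Moments and marginals of weights on assignments *)

Section Moments.
Variables (R : realFieldType) (T : finType).
Implicit Types (eps : {ffun T -> bool}) (I : {set T}).
Implicit Types (w : {ffun {ffun T -> bool} -> R}).

Definition moment w I : R := \sum_eps w eps * \prod_(A in I) (eps A)%:R.

Lemma prodr_bool eps I :
  \prod_(A in I) (eps A)%:R = (I \subset [set A | eps A])%:R :> R.
Proof.
case: (boolP (I \subset _)) => [/subsetP sI|].
  by rewrite big1 // => A /sI; rewrite inE => ->.
case/subsetPn => A AI; rewrite inE => /negPf epsA.
by rewrite (bigD1 A) //= epsA mul0r.
Qed.

Lemma moment_set0 w : moment w set0 = \sum_eps w eps.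
Proof. by apply: eq_bigr => eps _; rewrite big_set0 mulr1. Qed.

(* Möbius inversion on the lattice of subsets *)
Lemma moment_inj w w' : (forall I, moment w I = moment w' I) -> w = w'.
Proof.
move=> eq_ww'; apply/ffunP => eps; apply/eqP; rewrite -subr_eq0; apply/eqP.
(* Induction on the number of zeros of [eps], starting from the all-ones assignment. *)
have [k] := ubnP #|~: [set A | eps A]|; elim: k eps => // k IH eps le_k.
pose I := [set A | eps A].
have : \sum_eps (w eps - w' eps) * \prod_(A in I) (eps A)%:R = 0.
  under eq_bigr => ? _ do rewrite mulrBl.
  by rewrite sumrB; apply/eqP; rewrite subr_eq0; apply/eqP/eq_ww'.
(* Only assignments equal to [1] on all of [I] survive; those other than [eps] have fewer zeros and
   are covered by induction. *)
rewrite (bigD1 eps) //= prodr_bool -/I subxx mulr1.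
rewrite [X in _ + X]big1 ?addr0 // => eps' ne.
rewrite prodr_bool; case: (boolP (I \subset _)) => [sub|]; last by rewrite mulr0.
rewrite mulr1; apply: IH; rewrite -ltnS; apply: leq_trans le_k.
rewrite ltnS; apply: proper_card; rewrite properC properEneq sub andbT.
apply: contraNneq ne => eqI; apply/eqP/ffunP => A.
by move/setP/(_ A): eqI; rewrite !inE.
Qed.

End Moments.

Definition marginal (R : realFieldType) (T T' : finType) (phi : T -> T')
    (w : {ffun {ffun T' -> bool} -> R}) : {ffun {ffun T -> bool} -> R} :=
  [ffun eps : {ffun T -> bool} =>
    \sum_(eps' : {ffun T' -> bool} | [ffun A => eps' (phi A)] == eps) w eps'].

(** The assignment pulled back along [phi] is [1] on [I] exactly when the original is [1] on the
    image of [I]. *)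
Lemma moment_marginal (R : realFieldType) (T T' : finType) (phi : T -> T')
    (w : {ffun {ffun T' -> bool} -> R}) (I : {set T}) :
  moment (marginal phi w) I = moment w (phi @: I).
Proof.
rewrite /moment [RHS](partition_big
  (fun eps' : {ffun T' -> bool} => [ffun A => eps' (phi A)]) xpredT) //=.
apply: eq_bigr => eps _; rewrite ffunE mulr_suml; apply: eq_bigr => eps' /eqP <-.
rewrite !prodr_bool; congr (_ * _%:R); congr nat_of_bool.
apply/subsetP/subsetP => sI A.
  by case/imsetP => B /sI; rewrite !inE ffunE => ? ->.
by move=> AI; rewrite inE ffunE; move: (sI _ (imset_f phi AI)); rewrite inE.
Qed.

Lemma marginal_ge0 (R : realFieldType) (T T' : finType) (phi : T -> T')
    (w : {ffun {ffun T' -> bool} -> R}) :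
  (forall eps, 0 <= w eps) -> forall eps, 0 <= marginal phi w eps.
Proof. by move=> w_ge0 eps; rewrite ffunE sumr_ge0. Qed.

Lemma sum_marginal (R : realFieldType) (T T' : finType) (phi : T -> T')
    (w : {ffun {ffun T' -> bool} -> R}) :
  \sum_eps marginal phi w eps = \sum_eps w eps.
Proof. by rewrite -!moment_set0 moment_marginal imset0. Qed.

(** * Gluing subsystems along the first parties *)

Section Gluing.
Variables (R : realFieldType) (p m : nat).
Local Notation F := (first_meas p m).
Implicit Types (f : {ffun F -> bool}).

Definition join_assignment n f (b : {ffun 'I_n -> bool}) :
    {ffun meas p m n -> bool} :=
  [ffun A => match A with inl a => f a | inr s => b s end].

Lemma sum_join_assignment n (G : {ffun meas p m n -> bool} -> R) :
  \sum_eps G eps = \sum_f \sum_(b : {ffun 'I_n -> bool}) G (join_assignment f b).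
Proof.
rewrite pair_big /= (reindex (fun fb => join_assignment fb.1 fb.2)) //=.
exists (fun eps : {ffun meas p m n -> bool} =>
  ([ffun a : F => eps (inl a)], [ffun s : 'I_n => eps (inr s)])).
  by case=> f b _; congr pair; apply/ffunP => x; rewrite !ffunE.
by move=> eps _; apply/ffunP => -[a|s]; rewrite !ffunE.
Qed.

Lemma marginal_first (w : {ffun {ffun meas p m 1 -> bool} -> R}) f :
  marginal (inl : F -> meas p m 1) w f =
  \sum_(beta : bool) w (join_assignment f [ffun=> beta]).
Proof.
rewrite ffunE big_mkcond sum_join_assignment (bigD1 f) //= [X in _ + X]big1.
  rewrite addr0 (reindex (fun beta : bool => [ffun=> beta])) /=.
    apply: eq_bigr => beta _; case: eqP => // -[].
    by apply/ffunP => a; rewrite !ffunE.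
  exists (fun b : {ffun 'I_1 -> bool} => b ord0) => [beta|b] _.
    by rewrite ffunE.
  by apply/ffunP => i; rewrite ffunE (ord1 i).
move=> f' ne; apply: big1 => b _; case: eqP => // eqf; case/eqP: ne.
by rewrite -eqf; apply/ffunP => a; rewrite !ffunE.
Qed.

(* The measurements of the last party are made conditionally independent given
   those of the first parties; where [mu] vanishes so do all the [w s], and the
   junk value of the division is irrelevant. *)
Lemma gluing n (w : 'I_n -> {ffun {ffun meas p m 1 -> bool} -> R})
    (mu : {ffun {ffun F -> bool} -> R}) :
  (forall s eps, 0 <= w s eps) ->
  (forall s, marginal (inl : F -> meas p m 1) (w s) = mu) ->
  (forall f, 0 <= mu f) ->
  exists W : {ffun {ffun meas p m n -> bool} -> R},
    (forall eps, 0 <= W eps) /\ forall s, marginal (relabel (fun=> s)) W = w s.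
Proof.
move=> w_ge0 w_mu mu_ge0.
pose v f s beta := w s (join_assignment f [ffun=> beta]).
have sum_v f s : \sum_beta v f s beta = mu f by rewrite -(w_mu s) marginal_first.
pose W := [ffun eps : {ffun meas p m n -> bool} =>
  let f := [ffun a : F => eps (inl a)] in
  mu f * \prod_s (v f s (eps (inr s)) / mu f)].
have WE f b : W (join_assignment f b) = mu f * \prod_s (v f s (b s) / mu f).
  rewrite ffunE /=; have -> : [ffun a => join_assignment f b (inl a)] = f.
    by apply/ffunP => a; rewrite !ffunE.
  by congr (_ * _); apply: eq_bigr => s _; rewrite ffunE.
exists W; split=> [eps|s].
  rewrite ffunE mulr_ge0 // prodr_ge0 // => s _.
  by rewrite divr_ge0 // w_ge0.
apply/ffunP => eps1; pose f1 := [ffun a : F => eps1 (inl a)].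
pose beta := eps1 (inr ord0).
have -> : w s eps1 = v f1 s beta.
  by congr (w s _); apply/ffunP => -[a|t]; rewrite !ffunE // (ord1 t).
rewrite ffunE big_mkcond sum_join_assignment (bigD1 f1) //= [X in _ + X]big1.
  rewrite addr0.
  have condE b : ([ffun A => join_assignment f1 b (relabel (fun=> s) A)] == eps1)
      = (b s == beta).
    apply/eqP/eqP => [eqe|bs]; first by rewrite /beta -eqe !ffunE.
    apply/ffunP => -[a|t]; rewrite !ffunE /=; first by rewrite /f1 ffunE.
    by rewrite bs (ord1 t).
  under eq_bigr => b _ do rewrite condE WE.
  have [mu0|mu_neq0] := eqVneq (mu f1) 0.
    rewrite big1 => [|b _]; last by rewrite mu0 mul0r if_same.
    have /psumr_eq0P : \sum_beta v f1 s beta = 0 by rewrite sum_v.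
    by move=> -> // ? _; apply: w_ge0.
  (* The constraint [b s == beta] is absorbed into the factor at [s], so the sum over [b] becomes a
     product of sums. Those at [t] other than [s] are total conditional probabilities, equal to
     [1]. *)
  pose q t beta' : R :=
    v f1 t beta' / mu f1 * (if t == s then (beta' == beta)%:R else 1).
  transitivity (mu f1 * \sum_(b : {ffun 'I_n -> bool}) \prod_t q t (b t)).
    rewrite mulr_sumr; apply: eq_bigr => b _; rewrite [in RHS]big_split /=.
    rewrite -big_mkcond /= big_pred1_eq.
    by case: eqP => _; rewrite ?mulr1 ?mulr0.
  rewrite -bigA_distr_bigA (bigD1 s) //= [X in _ * (_ * X)]big1 => [|t /negPf ts].
    rewrite mulr1 (bigD1 beta) //= [X in _ + X]big1 => [|b' /negPf ne].
      by rewrite /q !eqxx mulr1 addr0 mulrC divfK.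
    by rewrite /q eqxx ne mulr0.
  under eq_bigr => b' _ do rewrite /q ts mulr1.
  by rewrite -mulr_suml sum_v divff.
move=> f' ne; apply: big1 => b _; case: eqP => // eqf; case/eqP: ne.
by apply/ffunP => a; rewrite ffunE -eqf !ffunE.
Qed.

End Gluing.

(** * Coordinates before and after elimination *)

Section Coordinates.
Variables (p m : nat).

Lemma compatibleP n (I : {set meas p m n}) :
  reflect {in I &, injective (@party p m n)} (compatible I).
Proof.
apply: (iffP forall_inP) => [cI A B AI BI AB|injI A AI].
  by have /forall_inP/(_ B BI) := cI A AI; rewrite AB eqxx => /eqP.
by apply/forall_inP => B BI; apply/implyP => /eqP /injI ->.
Qed.

Lemma compatible_relabel_set n n' (g : 'I_n -> 'I_n') (I : {set meas p m n}) :
  injective g -> compatible (relabel_set g I) = compatible I.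
Proof.
move=> ginj.
have partyE A : party (relabel g A) = party A :> option 'I_p.-1.
  by case: A.
have relabel_inj : injective (@relabel p m _ _ g).
  by move=> [a|s] [b|t] //= [] => [->|/ginj ->].
apply/compatibleP/compatibleP => cI A B.
  move=> AI BI AB; apply: relabel_inj; apply: cI; rewrite ?imset_f //.
  by rewrite !partyE.
by move=> /imsetP[A1 ? ->] /imsetP[B1 ? ->]; rewrite !partyE => /cI ->.
Qed.

Lemma relabel_set_eq0 n n' (g : 'I_n -> 'I_n') (I : {set meas p m n}) :
  (relabel_set g I == set0) = (I == set0).
Proof. exact: imset_eq0. Qed.

Lemma compatible_first_set n (J : {set first_meas p m}) :
  compatible (first_set n J) = (J \notin elim_vars p m).
Proof.
(* [elim_vars] refers to a last party without measurements; the empty map from ['I_0] to ['I_n] is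
   injective and preserves compatibility. *)
rewrite inE negbK -(relabel_set_first (widen_ord (leq0n n))).
by rewrite compatible_relabel_set // => -[].
Qed.

Lemma const_ord1_inj n (s : 'I_n) : injective ((fun=> s) : 'I_1 -> 'I_n).
Proof. by move=> i j _; rewrite (ord1 i) (ord1 j). Qed.

Lemma relabel_copy_ext_coord n (s : 'I_n) (K : {set meas p m 1}) :
  K \in ext_coord p m 1 -> relabel_set (fun=> s) K \in ext_coord p m n.
Proof.
rewrite !inE relabel_set_eq0 compatible_relabel_set; last exact: const_ord1_inj.
case: (K == set0) => //= /orP[sK|->]; last by rewrite orbT.
by rewrite -(relabel_set_first ((fun=> s) : 'I_1 -> 'I_n)) imsetS.
Qed.

Lemma relabel_copy_bell_coord n (s : 'I_n) (K : {set meas p m 1}) :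
  relabel_set (fun=> s) K \in bell_coord p m n -> K \in ext_coord p m 1.
Proof.
rewrite !inE relabel_set_eq0 compatible_relabel_set; last exact: const_ord1_inj.
by case/andP=> -> ->; rewrite orbT.
Qed.

Lemma ext_coord_elim n (I : {set meas p m n}) :
  I \in ext_coord p m n -> I \notin bell_coord p m n ->
  exists2 J, J \in elim_vars p m & I = first_set n J.
Proof.
rewrite !inE => /andP[-> /=] /orP[sI|->] // ncI.
have IE : I = first_set n [set f | inl f \in I].
  apply/setP => -[f|s]; first by rewrite mem_first_set_inl inE.
  rewrite mem_first_set_inr; apply/negbTE/negP => /(subsetP sI).
  by rewrite mem_first_set_inr.
exists [set f | inl f \in I] => //.
by apply: contraNT ncI => Je; rewrite IE compatible_first_set.
Qed.

Lemma bell_coord_not_elim n (J : {set first_meas p m}) :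
  J \in elim_vars p m -> first_set n J \notin bell_coord p m n.
Proof.
by move=> Je; rewrite inE negb_and compatible_first_set Je orbT.
Qed.

(** Compatibility leaves at most one measurement of the last party, which fixes the subsystem; if
    there is none, any [s] serves, and [0 < n] provides one. *)
Lemma bell_coord_copy n (I : {set meas p m n}) :
  (0 < n)%N -> I \in bell_coord p m n ->
  exists s : 'I_n, exists K : {set meas p m 1}, I = relabel_set (fun=> s) K.
Proof.
move=> n_gt0; rewrite inE => /andP[_ /compatibleP cI].
suff [s sI] : exists s : 'I_n, I \subset inr s |: first_set n setT.
  by exists s, (relabel_set (fun=> ord0 : 'I_1) I); rewrite relabel_set_copyK.
have [/existsP[s sI]|/existsPn noI] := boolP [exists s : 'I_n, inr s \in I].
  exists s; apply/subsetP => -[f|t] tI; rewrite inE.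
    by rewrite mem_first_set_inl !inE.
  by rewrite (cI _ _ tI sI) // inE eqxx.
exists (Ordinal n_gt0); apply/subsetP => -[f|t] tI; rewrite inE.
  by rewrite mem_first_set_inl !inE.
by move: (noI t); rewrite tI.
Qed.

End Coordinates.

(** * The resulting inequalities describe the correlation polytope *)

Section BellPolytope.
Variables (R : realFieldType) (p m : nat).
Variables (L : seq (lineq R {set meas p m 1})) (e : seq {set first_meas p m}).
Hypothesis hL : describes_polytope L (ext_coord p m 1).
Hypothesis he : e =i elim_vars p m.

(** Such an [I] is either an eliminated variable or absent from the joint system, and combinations
    create no new variables. *)
Lemma bell_inequalities_support n c (I : {set meas p m n}) :
  c \in bell_inequalities L e n -> I \notin bell_coord p m n -> c.2 I = 0.
Proof.
move=> cB nI; have [extI|next] := boolP (I \in ext_coord p m n).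
  have [J Je IE] := ext_coord_elim extI nI.
  by apply: fourier_motzkin_elim cB; rewrite IE map_f // he.
apply: fourier_motzkin_eq0 cB => _ /joint_systemP[s [a aL ->]].
rewrite copy_atE ffunE big1 // => K /eqP KI; apply: hL.1 => //.
by apply: contraNN next => /(relabel_copy_ext_coord s); rewrite KI.
Qed.

Lemma satisfies_joint_system n (y : {set meas p m n} -> R) :
  (forall a, a \in joint_system n L -> satisfies a y) <->
  (forall s, corr_polytope (ext_coord p m 1) (y \o relabel_set (fun=> s))).
Proof.
split=> [Ly s|Ly _ /joint_systemP[s [a aL ->]]].
  apply/hL.2 => a aL; apply/satisfies_pushforward; rewrite -copy_atE.
  by apply: Ly; apply/joint_systemP; exists s, a.
by rewrite copy_atE; apply/satisfies_pushforward; move: a aL; apply/hL.2.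
Qed.

Lemma glue_copies n (y : {set meas p m n} -> R) : (0 < n)%N ->
  (forall s, corr_polytope (ext_coord p m 1) (y \o relabel_set (fun=> s))) ->
  corr_polytope (bell_coord p m n) y.
Proof.
move=> n_gt0 /fin_all_exists[w hw].
have w_ge0 s eps : 0 <= w s eps by case: (hw s).
pose mu s := marginal (inl : first_meas p m -> meas p m 1) (w s).
pose s0 := Ordinal n_gt0.
have mu_eq s : mu s = mu s0.
  apply: moment_inj => J; rewrite !moment_marginal.
  (* The empty set is not a coordinate; its moment is the total weight, [1] for every [s]. For
     nonempty [J] the variable is shared by all subsystems. *)
  have [->|J0] := eqVneq J set0.
    by rewrite !imset0 !moment_set0; have [_ -> _] := hw s; have [_ -> _] := hw s0.
  have JE : first_set 1 J \in ext_coord p m 1.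
    by rewrite inE imset_eq0 J0 imsetS ?subsetT.
  have momentE r : moment (w r) (first_set 1 J) = y (first_set n J).
    by have [_ _ /(_ _ JE) /=] := hw r; rewrite relabel_set_first.
  exact: etrans (momentE s) (esym (momentE s0)).
have [|W [W_ge0 W_w]] := gluing w_ge0 mu_eq; first exact: marginal_ge0.
exists W; split=> // [|I IB].
  by rewrite -(sum_marginal (@relabel p m 1 n (fun=> s0))) W_w; case: (hw s0).
have [s [K IK]] := bell_coord_copy n_gt0 IB.
rewrite -/(moment W I) IK -moment_marginal W_w.
have [_ _ wK] := hw s; apply: wK.
by rewrite IK in IB; apply: relabel_copy_bell_coord IB.
Qed.

Lemma bell_inequalities_describe n : (0 < n)%N ->
  describes_polytope (bell_inequalities L e n) (bell_coord p m n).
Proof.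
move=> n_gt0; split=> [c cB I|x]; first exact: bell_inequalities_support.
(* Completeness supplies values [y] of the eliminated variables that solve the joint system and
   agree with [x] on Bell coordinates. *)
split=> [/fourier_motzkin_complete[y [yx /satisfies_joint_system]]|].
  move=> /(glue_copies n_gt0)[w [w_ge0 w1 wy]]; exists w; split=> // I IB.
  rewrite -wy // yx //; apply: contraTN IB => /mapP[J Je ->].
  by rewrite bell_coord_not_elim // -he.
case=> w [w_ge0 w1 wx] c cB.
(* Since [x] is arbitrary off the Bell coordinates, soundness is applied to the moments of [w],
   which agree with [x] wherever [c] has a nonzero coefficient. *)
have : satisfies c (moment w).
  apply: fourier_motzkin_sound cB; apply/satisfies_joint_system => s.
  exists (marginal (relabel (fun=> s)) w).
  split=> [||K _]; [exact: marginal_ge0|by rewrite sum_marginal|].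
  by rewrite -/(moment _ _) moment_marginal.
rewrite /satisfies; suff -> : \sum_I c.2 I * moment w I = \sum_I c.2 I * x I by [].
apply: eq_bigr => I _; have [IB|nI] := boolP (I \in bell_coord p m n).
  by rewrite wx.
by rewrite (bell_inequalities_support cB nI) !mul0r.
Qed.

End BellPolytope.

Theorem mainTheorem1 (R : realFieldType) (p m n : nat)
    (hp : (0 < p)%N) (hmn : (m < n)%N)
    (L : seq (lineq R {set meas p m 1}))
    (hL : describes_polytope L (ext_coord p m 1))
    (e : seq {set first_meas p m})
    (e_uniq : uniq e) (he : e =i elim_vars p m) :
  let N := (2 ^ num_elim p m)%N in
  [/\ describes_polytope (bell_inequalities L e n) (bell_coord p m n),
      describes_polytope (bell_inequalities L e N) (bell_coord p m N) &
      forall c : lineq R {set meas p m n},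
        c \in bell_inequalities L e n <->
        exists2 c' : lineq R {set meas p m N},
          c' \in bell_inequalities L e N & same_family c c'].
Proof.
move=> N; have n_gt0 : (0 < n)%N by apply: leq_ltn_trans hmn.
(* An order without repetition has exactly [k] steps, which turns the bound [2 ^ size e] into
   [2 ^ k]. *)
have size_e : size e = num_elim p m.
  by rewrite -(card_uniqP e_uniq); apply: eq_card.
split=> [||c]; [exact: bell_inequalities_describe| |].
  by apply: bell_inequalities_describe; rewrite ?expn_gt0.
by apply: bell_inequalities_families; rewrite // size_e.
Qed.
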